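(* Let $(\mathcal{A},\phi)$ be a noncommutative probability space and $(x_i)_{i\in\mathbb{N}}$ a sequence of random variables in $\mathcal{A}$. If the joint distribution of $(x_i)_{i\in\mathbb{N}}$ is invariant under the coactions $L_n$ of the quantum semigroups $B_s(n)$, then $\phi(x_{i_1}x_{i_2}\cdots x_{i_k})=0$ for all $k\in\mathbb{N}$ and all $i_1,\dots,i_k\in\mathbb{N}$.
   Context: A noncommutative probability space is a unital algebra $\mathcal{A}$ over $\mathbb{C}$ with a linear functional $\phi:\mathcal{A}\to\mathbb{C}$. $\mathbb{N}=\{1,2,\dots\}$. $\mu_{x_1,\dots,x_n}:\mathbb{C}\langle X_1,\dots,X_n\rangle\to\mathbb{C}$ is the joint distribution: the linear functional with $\mu(X_{i_1}\cdots X_{i_k})=\phi(x_{i_1}\cdots x_{i_k})$ and $\mu(1)=1$. $B_s(n)$ is the universal unital $C^*$-algebra, with unit $I$, generated by orthogonal projections $u_{i,j}$ ($i,j=1,\dots,n$) and an orthogonal projection $\mathbf{P}$ such that $u_{i,k}u_{i,l}=0=u_{k,i}u_{l,i}$ whenever $k\ne l$, and $\mathbf{P}=\sum_{k=1}^n u_{k,i}\mathbf{P}$ for all $1\le i\le n$. $L_n:\mathbb{C}\langle X_1,\dots,X_n\rangle\to\mathbb{C}\langle X_1,\dots,X_n\rangle\otimes B_s(n)$ is the algebra homomorphism with $L_n(1)=1\otimes I$ and $L_n(X_i)=\sum_{k=1}^nX_k\otimes u_{k,i}$. The joint distribution of $(x_i)_{i\in\mathbb{N}}$ is invariant under the coactions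 $L_n$ of the $B_s(n)$ if for all $n$ and all $p\in\mathbb{C}\langle X_1,\dots,X_n\rangle$: $\mu_{x_1,\dots,x_n}(p)I=(\mu_{x_1,\dots,x_n}\otimes id)(L_n(p))$. *)

(* Defs.v *)
From HB Require Import structures.
From mathcomp Require Import all_boot all_order all_algebra.
From mathcomp Require Import finmap.
From mathcomp Require Import all_classical all_reals all_analysis.
From mathcomp Require Import complex.
From mathcomp Require Import -(notations) monalg.
Set Implicit Arguments.
Unset Strict Implicit.
Unset Printing Implicit Defensive.
Import Order.TTheory GRing.Theory Num.Theory.
Import numFieldNormedType.Exports.
Local Open Scope classical_set_scope.
Local Open Scope ring_scope.
(* Unital C*-algebras over the complex numbers [R[i]], with the library's
   complete norm; its values are the nonnegative reals of [R[i]].  The product is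
   a field of the mixin, and the ring and algebra structures are derived below,
   because the hierarchy has no join of rings and normed modules outside numeric
   domains. *)
HB.mixin Record isCStarAlgebra (R : realType) B
    of CompleteNormedModule R[i] B := {
  cstar_one : B;
  cstar_mul : B -> B -> B;
  cstar_mulA : associative cstar_mul;
  cstar_mul1x : left_id cstar_one cstar_mul;
  cstar_mulx1 : right_id cstar_one cstar_mul;
  cstar_mulDl : left_distributive cstar_mul +%R;
  cstar_mulDr : right_distributive cstar_mul +%R;
  cstar_scaleAl : forall (c : R[i]) (x y : B),
    c *: cstar_mul x y = cstar_mul (c *: x) y;
  cstar_scaleAr : forall (c : R[i]) (x y : B),
    c *: cstar_mul x y = cstar_mul x (c *: y);
  cstar_one_neq0 : cstar_one != 0;
  star : B -> B;
  starD : {morph star : x y / x + y};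
  starZ : forall (c : R[i]) (x : B), star (c *: x) = c^* *: star x;
  star_mul : forall x y : B, star (cstar_mul x y) = cstar_mul (star y) (star x);
  starK : involutive star;
  cstar_normM : forall x y : B, `|cstar_mul x y| <= `|x| * `|y|;
  cstar_norm : forall x : B, `|cstar_mul (star x) x| = `|x| ^+ 2
}.

#[short(type="cstarAlgType")]
HB.structure Definition CStarAlgebra (R : realType) :=
  {B of CompleteNormedModule R[i] B & isCStarAlgebra R B}.

Section CStarAlgebraRing.
Variables (R : realType) (B : cstarAlgType R).
HB.instance Definition _ := GRing.Zmodule_isNzRing.Build (CStarAlgebra.sort B)
  (@cstar_mulA R B) (@cstar_mul1x R B) (@cstar_mulx1 R B)
  (@cstar_mulDl R B) (@cstar_mulDr R B) (@cstar_one_neq0 R B).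
HB.instance Definition _ := GRing.LSemiModule_isLSemiAlgebra.Build R[i]
  (CStarAlgebra.sort B) (@cstar_scaleAl R B).
HB.instance Definition _ := GRing.LSemiAlgebra_isSemiAlgebra.Build R[i]
  (CStarAlgebra.sort B) (@cstar_scaleAr R B).
End CStarAlgebraRing.

Definition orth_proj (R : realType) (B : cstarAlgType R) (p : B) : Prop :=
  star p = p /\ p * p = p.

Record Bs_relations (R : realType) (n : nat) (B : cstarAlgType R)
    (u : 'I_n -> 'I_n -> B) (P : B) : Prop := {
  Bs_proj_u : forall i j, orth_proj (u i j);
  Bs_proj_P : orth_proj P;
  Bs_row : forall i k l, k != l -> u i k * u i l = 0;
  Bs_col : forall i k l, k != l -> u k i * u l i = 0;
  Bs_sum : forall i, P = \sum_(k < n) u k i * P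
}.

(* [G] generates [B]: the only norm-closed unital *-subalgebra of [B] that
   contains [G] is [B]. *)
Definition cstar_generates (R : realType) (B : cstarAlgType R) (G : set B) :=
  forall S : set B, closed S -> S 1 ->
    (forall (c : R[i]) (x y : B), S x -> S y -> S (c *: x + y)) ->
    (forall x y, S x -> S y -> S (x * y)) ->
    (forall x, S x -> S (star x)) ->
    G `<=` S -> S = setT.

(* [B], with generators [u] and [P], is the universal unital C*-algebra $B_s(n)$;
   this determines it up to a unique *-isomorphism. *)
Record is_Bs (R : realType) (n : nat) (B : cstarAlgType R)
    (u : 'I_n -> 'I_n -> B) (P : B) : Prop := {
  is_Bs_rel : Bs_relations u P;
  is_Bs_gen : cstar_generates ([set b | exists i j, b = u i j] `|` [set P]);
  is_Bs_univ : forall (D : cstarAlgType R) (v : 'I_n -> 'I_n -> D) (Q : D),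
    Bs_relations v Q ->
    exists f : {lrmorphism B -> D}, [/\ forall x, f (star x) = star (f x),
      forall i j, f (u i j) = v i j & f P = Q]
}.

(* Noncommutative polynomials: the algebra of the free monoid of words on
   $X_0,..,X_{n-1}$.  The coefficients in $S$ commute with the variables. *)
Notation ncpoly S n := (malg (fmonom 'I_n) S).

Definition ncX (S : nzRingType) (n : nat) (i : 'I_n) : ncpoly S n :=
  mkmalgU (fmu i) 1.

(* With $S$ a C*-algebra $B$, [ncpoly S n] is the algebraic tensor
   product $C<X_1,..,X_n> (x) B$: the words form a basis of the first factor, so
   a tensor is a finitely supported $B$-valued function on words, and the
   product (p (x) a) (q (x) b) = pq (x) ab is the one of [malg]. *)
Section Coaction.
Variables (R : realType) (n : nat) (B : cstarAlgType R).

(* The elementary tensor p (x) b. *)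
Definition tensor (p : ncpoly R[i] n) (b : B) : ncpoly B n :=
  \sum_(w <- msupp p) mkmalgU w (mcoeff w p *: b).

(* The map f (x) id, followed by C (x) B = B. *)
Definition tensor_id (f : ncpoly R[i] n -> R[i]) (q : ncpoly B n) : B :=
  \sum_(w <- msupp q) f (mkmalgU w 1) *: mcoeff w q.

(* c |-> c 1 (x) I *)
Definition nc_const (c : R[i]) : ncpoly B n := malgC c%:A.

Definition Ln_word (u : 'I_n -> 'I_n -> B) (w : fmonom 'I_n) : ncpoly B n :=
  \prod_(i <- w) \sum_(k < n) tensor (ncX R[i] k) (u k i).

Definition Ln (u : 'I_n -> 'I_n -> B) : ncpoly R[i] n -> ncpoly B n :=
  mmap nc_const (Ln_word u).
End Coaction.
Arguments nc_const {R n B} c.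

(* The variables are numbered from 0. *)
Section Distribution.
Variables (R : realType) (A : algType R[i]) (phi : {scalar A}) (x : nat -> A).

(* The value on the empty word is 1 by convention, whether or not
   [phi 1 = 1]. *)
Definition joint_moment (n : nat) (w : fmonom 'I_n) : R[i] :=
  if nilp w then 1 else phi (\prod_(i <- w) x i).

Definition joint_dist (n : nat) : ncpoly R[i] n -> R[i] :=
  mmap idfun (@joint_moment n).

Definition coaction_invariant (B : nat -> cstarAlgType R)
    (u : forall n, 'I_n -> 'I_n -> B n) : Prop :=
  forall n, (0 < n)%N -> forall p : ncpoly R[i] n,
    joint_dist p *: (1 : B n) = tensor_id (@joint_dist n) (Ln (u n) p).
End Distribution.

Lemma fgU1U (K : monomType) (S : nzRingType) (a b : S) (k l : K) :
  mkmalgU k a * mkmalgU l b = mkmalgU (mmul k l) (a * b) :> malg K S.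
Proof. by rewrite malgM_def fgmulUU. Qed.

Section TensorTheory.
Variables (R : realType) (n : nat) (B : cstarAlgType R).
Implicit Types (u : 'I_n -> 'I_n -> B) (p q : ncpoly R[i] n).

Lemma tensorE p (b : B) w : mcoeff w (tensor p b) = mcoeff w p *: b.
Proof.
rewrite /tensor raddf_sum /= [in RHS](monalgE p) raddf_sum /= scaler_suml.
by apply: eq_bigr => v _; rewrite !mcoeffU scalerMnl.
Qed.

Lemma tensor_mul p q (a b : B) :
  tensor (p * q) (a * b) = tensor p a * tensor q b.
Proof.
apply/malgP => w; rewrite tensorE.
have le (r : ncpoly R[i] n) (c : B) : {subset msupp (tensor r c) <= msupp r}.
  move=> v; rewrite -!mcoeff_neq0 tensorE; apply: contraNneq => ->.
  by rewrite scale0r.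
rewrite mcoeffMl.
rewrite (@mcoeffMlw _ _ (msupp p) (msupp q)); last 2 first.
- by apply/fsubsetP/le.
- by apply/fsubsetP/le.
rewrite scaler_suml; apply: eq_bigr => k1 _.
rewrite scaler_suml; apply: eq_bigr => k2 _.
rewrite !tensorE -scalerAl -scalerAr scalerA; case: eqP => _.
  by rewrite !mulr1n.
by rewrite !mulr0n scale0r.
Qed.

Lemma tensor_idE (f : ncpoly R[i] n -> R[i]) p (b : B) :
  (forall (c : R[i]) p q, f (c *: p + q) = c * f p + f q) ->
  tensor_id f (tensor p b) = f p *: b.
Proof.
move=> fL.
have f0 : f 0 = 0.
  by have := fL (-1) 0 0; rewrite scaler0 addr0 mulN1r addNr.
have le (v : fmonom 'I_n) : v \in msupp (tensor p b) -> v \in msupp p.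
  rewrite -!mcoeff_neq0 tensorE; apply: contraNneq => ->.
  by rewrite scale0r.
rewrite /tensor_id (big_fset_incl _ (B := msupp p)) /=; last 2 first.
- by apply/fsubsetP/le.
- by move=> v _ /mcoeff_outdom ->; rewrite scaler0.
under eq_bigr do rewrite tensorE scalerA.
rewrite -scaler_suml; congr (_ *: _).
have fE (s : seq (fmonom 'I_n)) :
    \sum_(v <- s) f (mkmalgU v 1) * mcoeff v p =
    f (\sum_(v <- s) mkmalgU v (mcoeff v p)).
  elim: s => [|v s IH]; first by rewrite !big_nil f0.
  rewrite !big_cons IH.
  have -> : mkmalgU v (mcoeff v p) = mcoeff v p *: mkmalgU v 1.
    by apply/malgP => w; rewrite mcoeffZ !mcoeffU mulrnAr mulr1.
  by rewrite fL mulrC.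
by rewrite fE -monalgE.
Qed.

Lemma tensorU (w : fmonom 'I_n) (c : R[i]) (b : B) :
  tensor (mkmalgU w c : ncpoly R[i] n) b = mkmalgU w (c *: b).
Proof.
apply/malgP => v; rewrite tensorE !mcoeffU.
by case: eqP => _; rewrite ?mulr1n ?mulr0n ?scale0r.
Qed.

Lemma nc_const_comm (c : R[i]) (q : ncpoly B n) : GRing.comm (nc_const c) q.
Proof.
rewrite /GRing.comm [q]monalgE mulr_sumr mulr_suml; apply: eq_bigr => w _.
by rewrite /nc_const /malgC !fgU1U mul1m mulm1 mulr_algl mulr_algr.
Qed.

Lemma nc_const_zmod_morphism : zmod_morphism (@nc_const R n B).
Proof. by move=> a b; rewrite /nc_const scalerBl raddfB. Qed.

Lemma nc_const_monoid_morphism : monoid_morphism (@nc_const R n B).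
Proof.
split=> [|a b]; rewrite /nc_const ?scale1r //.
by rewrite -mpolyCM -scalerAl mul1r scalerA.
Qed.

HB.instance Definition _ := GRing.isZmodMorphism.Build R[i] (ncpoly B n)
  (@nc_const R n B) nc_const_zmod_morphism.
HB.instance Definition _ := GRing.isMonoidMorphism.Build R[i] (ncpoly B n)
  (@nc_const R n B) nc_const_monoid_morphism.

Lemma Ln_word_mmorphism u : mmorphism (Ln_word u).
Proof.
by split=> [v w|]; rewrite /Ln_word ?fmM ?big_cat // fm1 big_nil.
Qed.

HB.instance Definition _ u := isMultiplicative.Build (fmonom 'I_n) (ncpoly B n)
  (Ln_word u) (Ln_word_mmorphism u).

HB.instance Definition _ u := GRing.isZmodMorphism.Build
  (ncpoly R[i] n) (ncpoly B n) (Ln u) (@mmap_is_additive _ _ _ (@nc_const R n B) _).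
Lemma Ln_monoid_morphism u : monoid_morphism (Ln u).
Proof.
by have [] := commr_mmap_is_multiplicative
  (fun (g : ncpoly R[i] n) m m' => nc_const_comm (mcoeff m g) (Ln_word u m')).
Qed.

HB.instance Definition _ u := GRing.isMonoidMorphism.Build
  (ncpoly R[i] n) (ncpoly B n) (Ln u) (Ln_monoid_morphism u).

Lemma LnZ u (c : R[i]) p : Ln u (c *: p) = nc_const c * Ln u p.
Proof. exact: mmapZ. Qed.

Lemma LnX u i :
  Ln u (ncX R[i] i) = \sum_(k < n) tensor (ncX R[i] k) (u k i).
Proof.
by rewrite /Ln mmapU /= /nc_const scale1r mpolyC1E mul1r /Ln_word fmU big_seq1.
Qed.
End TensorTheory.

Section DistributionTheory.
Variables (R : realType) (A : algType R[i]) (phi : {scalar A}) (x : nat -> A).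

Lemma joint_dist_linear n (c : R[i]) (p q : ncpoly R[i] n) :
  joint_dist phi x (c *: p + q) = c * joint_dist phi x p + joint_dist phi x q.
Proof.
rewrite /joint_dist mmapD; congr (_ + _).
rewrite (mmapEw (msuppZ_le _ _)) mmapE big_distrr /=.
by apply: eq_bigr => w _; rewrite mcoeffZ mulrA.
Qed.

Lemma joint_dist_word n (w : fmonom 'I_n) :
  joint_dist phi x (mkmalgU w 1) = joint_moment phi x w.
Proof. by rewrite /joint_dist mmapU mul1r. Qed.

Lemma joint_dist1 n : joint_dist phi x (1 : ncpoly R[i] n) = 1.
Proof. by rewrite joint_dist_word /joint_moment fm1. Qed.

Lemma joint_dist_prod n k (i : 'I_k -> 'I_n) : (0 < k)%N ->
  joint_dist phi x (\prod_(j < k) ncX R[i] (i j)) = phi (\prod_(j < k) x (i j)).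
Proof.
case: k i => // k i _.
have E (s : seq 'I_n) :
    \prod_(j <- s) ncX R[i] j = mkmalgU (FMonom s) 1 :> ncpoly R[i] n.
  elim: s => [|a s IH]; first by rewrite big_nil -fmoneE.
  by rewrite big_cons IH fgU1U mulr1 /mmul /= fmmulE fmuE.
rewrite -(big_map i xpredT (ncX R[i] (n:=n))) E joint_dist_word /joint_moment.
by rewrite /= big_map /index_enum -enumT enum_ordSl /=.
Qed.
End DistributionTheory.

(* Main.v *)
(* The zero family satisfies the relations of $B_s(n)$ in any unital C*-algebra,
   so the universal property, applied to $B_s(n)$ itself, gives a unital
   endomorphism that kills every $u_{i,j}$.  Invariance writes the moment of a
   nonempty word, times the unit, as a combination of nonempty products of the
   $u_{i,j}$; applying the endomorphism shows that the moment is zero. *)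
Require Import Defs.
From HB Require Import structures.
From mathcomp Require Import all_boot all_order all_algebra.
From mathcomp Require Import all_classical all_reals all_analysis.
From mathcomp Require Import complex.
From mathcomp Require Import -(notations) monalg.
Import GRing.Theory.
Local Open Scope ring_scope.

Lemma star0 (R : realType) (D : cstarAlgType R) : star (0 : D) = 0.
Proof. by apply: (addIr (star (0 : D))); rewrite -starD !add0r. Qed.

(** Once every [u i j] is zero, [Bs_sum] forces the projection to be zero too when [n > 0]. *)
Lemma Bs_relations0 (R : realType) (n : nat) (D : cstarAlgType R) :
  Bs_relations (fun _ _ : 'I_n => 0 : D) 0.
Proof.
have proj0 : orth_proj (0 : D) by split; rewrite ?star0 ?mul0r.
split=> // [i k l _|i k l _|i]; rewrite ?mul0r //.
by rewrite big1 // => k _; rewrite mul0r.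
Qed.

Lemma is_Bs_morph_u0 {R : realType} {n : nat} {B : cstarAlgType R}
    {u : 'I_n -> 'I_n -> B} {P : B} : is_Bs u P ->
  exists f : {lrmorphism B -> B}, forall i j, f (u i j) = 0.
Proof.
move=> /is_Bs_univ /(_ _ _ _ (Bs_relations0 R n B)) [f [_ fu _]].
by exists f.
Qed.

(** A coefficient of [p * q] is a sum of products whose left factors are coefficients of [p], so
    nothing is asked of [q]. *)
Lemma morph_mcoeffM0 (K : monomType) (S T : nzRingType) (f : {rmorphism S -> T})
    (p q : malg K S) :
  (forall w, f (mcoeff w p) = 0) -> forall w, f (mcoeff w (p * q)) = 0.
Proof.
move=> fp w; rewrite mcoeffMl rmorph_sum big1 // => k1 _.
rewrite rmorph_sum big1 // => k2 _.
by rewrite rmorphMn rmorphM fp mul0r mul0rn.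
Qed.

Lemma morph_mcoeff_LnX0 {R : realType} {n : nat} {B : cstarAlgType R}
    {u : 'I_n -> 'I_n -> B} {f : {lrmorphism B -> B}} (i : 'I_n) :
  (forall i j, f (u i j) = 0) ->
  forall w, f (mcoeff w (Ln u (ncX R[i] i))) = 0.
Proof.
move=> fu w; rewrite LnX !raddf_sum big1 // => k _.
by rewrite /= tensorE linearZ /= fu scaler0.
Qed.

Lemma morph_tensor_id0 {R : realType} {n : nat} {B : cstarAlgType R}
    {f : {lrmorphism B -> B}} (g : ncpoly R[i] n -> R[i]) (q : ncpoly B n) :
  (forall w, f (mcoeff w q) = 0) -> f (tensor_id g q) = 0.
Proof.
move=> fq; rewrite /tensor_id raddf_sum big1 // => w _.
by rewrite /= linearZ /= fq scaler0.
Qed.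

Theorem proposition8p2 (R : realType)
    (A : algType R[i]) (phi : {scalar A}) (x : nat -> A)
    (B : nat -> cstarAlgType R)
    (u : forall n : nat, 'I_n -> 'I_n -> B n) (P : forall n : nat, B n)
    (hB : forall n : nat, (0 < n)%N -> is_Bs (u n) (P n))
    (hinv : coaction_invariant phi x u) :
  forall (k : nat) (i : 'I_k -> nat), (0 < k)%N ->
    phi (\prod_(j < k) x (i j)) = 0.
Proof.
move=> [//|k] i _.
(* Variables are numbered from 0, so [m.+1] of them cover all the indices. *)
pose m := \max_(j < k.+1) i j.
have [f fu] := is_Bs_morph_u0 (hB m.+1 isT).
pose i' (j : 'I_k.+1) : 'I_m.+1 := inord (i j).
have i'E j : i' j = i j :> nat by rewrite inordK // ltnS leq_bigmax.
have -> : \prod_(j < k.+1) x (i j) = \prod_(j < k.+1) x (i' j).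
  by apply: eq_bigr => j _; rewrite i'E.
rewrite -joint_dist_prod //.
have /(congr1 f) := hinv m.+1 isT (\prod_(j < k.+1) ncX R[i] (i' j)).
(* The word is nonempty; killing its first letter is enough. *)
rewrite [X in Ln _ X]big_ord_recl rmorphM morph_tensor_id0; last first.
  exact/morph_mcoeffM0/morph_mcoeff_LnX0.
(* Since [f] is unital, the moment times [1] is 0, and [1] is nonzero in [B m.+1]. *)
by move/eqP; rewrite linearZ /= rmorph1 scaler_eq0 oner_eq0 orbF => /eqP.
Qed.
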